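(* Let $G=(V,E)$ be a simple undirected graph with $V=\{v_1,\ldots,v_n\}$, let $K=\{v_1,\ldots,v_k\}$ with $k>1$, and assume that $K$ is an independent set, that each $v_i\in K$ has degree exactly $2$ with $N(v_i)=\{v_{k+2i-1},v_{k+2i}\}$ for $i\in[k]$, and that no two vertices of $K$ have a common neighbour. For each edge $v_iv_j\in E$ with $i<j$ let $x_{ij}$ be a distinct commuting indeterminate, and work over a field of characteristic two (e.g. $\mathrm{GF}(2^\ell)$). Define the $n\times n$ matrix $M_G$ with polynomial entries by: for $i\neq j$, $M_G(i,j)=x_{\min(i,j)\max(i,j)}$ if $v_iv_j\in E$ and $M_G(i,j)=0$ otherwise; $M_G(i,i)=1$ for $i>3k$ and $M_G(i,i)=0$ for $i\le 3k$; and finally the two entries $M_G(1,k+2)$ and $M_G(k+1,1)$ are set to $0$ (while $M_G(1,k+1)$ and $M_G(k+2,1)$ are left unchanged). Let $T=\{x_{i,k+2i-1},x_{i,k+2i}: i\in[k]\}$ and $t=\prod_{x\in T}x$. Then $G$ has a $K$-cycle if and only if $\det M_G$, viewed as a polynomial in the indeterminates $x_{ij}$, contains a monomial $m$ with non-zero coefficient such that $t$ divides $m$.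
   Context: A $K$-cycle in $G$ is a (simple) cycle in $G$ passing through every vertex of $K$ (possibly also through other vertices). $N(v)$ denotes the set of neighbours of $v$, and $[k]=\{1,\ldots,k\}$. *)

(* Defs.v *)
From mathcomp Require Import all_boot all_algebra.
From mathcomp.multinomials Require Import mpoly.

Set Implicit Arguments.
Unset Strict Implicit.
Unset Printing Implicit Defensive.

Import GRing.Theory.
Local Open Scope ring_scope.

(* The vertex set V = {v_1, ..., v_n} is 'I_n, and [label u] is the 1-based
   index of [u], i.e. u = v_(label u). All indices below are 1-based labels. *)
Definition label (n : nat) (u : 'I_n) : nat := u.+1.

Definition terminals (n k : nat) : {set 'I_n} := [set u : 'I_n | (label u <= k)%N].

Section Graph.

Variables (n : nat) (adj : rel 'I_n).

Definition simple_graph : Prop := ssrbool.symmetric adj /\ irreflexive adj.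

Definition nbhd (u : 'I_n) : {set 'I_n} := [set w | adj u w].

Definition independent (K : {set 'I_n}) : Prop :=
  {in K &, forall u w, ~~ adj u w}.

(* The bound 3 <= size excludes the degenerate cyclic sequences
   [::] and [:: u; w] accepted by [ucycle]. *)
Definition is_cycle (c : seq 'I_n) : Prop := (3 <= size c)%N /\ ucycle adj c.

Definition has_set_cycle (K : {set 'I_n}) : Prop :=
  exists2 c : seq 'I_n, is_cycle c & {subset K <= c}.

Definition is_edge (p : 'I_n * 'I_n) : bool := (p.1 < p.2)%N && adj p.1 p.2.

Definition edge : finType := {p : 'I_n * 'I_n | is_edge p}.

Variable F : fieldType.

(* Polynomials with exactly one indeterminate per edge. *)
Local Notation edge_poly := {mpoly F[#|{: edge}|]}.

Definition edge_var (e : edge) : edge_poly := 'X_(enum_rank e).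

(* x_(min(u,w) max(u,w)) if uw is an edge, and 0 otherwise. *)
Definition adj_entry (u w : 'I_n) : edge_poly :=
  if insub (if (u < w)%N then (u, w) else (w, u)) is Some e
  then edge_var e else 0.

Variable k : nat.

Definition MG : 'M[edge_poly]_n := \matrix_(u, w)
  if (label u == 1)%N && (label w == k + 2)%N then 0
  else if (label u == k + 1)%N && (label w == 1)%N then 0
  else if u == w then (if (3 * k < label u)%N then 1 else 0)
  else adj_entry u w.

Definition T_edges : {set edge} :=
  [set e : edge | let i := label (val e).1 in let j := label (val e).2 in
     (i <= k)%N && ((j == k + 2 * i - 1) || (j == k + 2 * i))%N].

Definition t_prod : edge_poly := \prod_(e in T_edges) edge_var e.

End Graph.

(* Main.v *)
(** In characteristic two the determinant is the sum of [\prod_u M u (s u)] over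
    all permutations [s], and each non-zero product is a monomial recording the
    edges [{u, s u}].  If [t] divides it, both edges at every terminal are used,
    so every terminal lies on a cycle of [s] of length at least three.  When the
    cycle of [v_1] misses some terminal, reversing the cycle of the first missed
    one gives a different permutation with the same monomial, because [M] is
    symmetric away from [v_1]; this involution cancels all such terms.  Hence a
    surviving monomial comes from a permutation whose cycle through [v_1] is a
    [K]-cycle.  Conversely, a [K]-cycle determines its permutation up to
    orientation, and the two zeroed entries kill one of the two orientations, so
    its monomial has coefficient 1. *)
Require Import Defs.
From mathcomp Require Import all_boot all_algebra fingroup perm.
From mathcomp Require Import zify.
From mathcomp.multinomials Require Import mpoly.

Set Implicit Arguments.
Unset Strict Implicit.
Unset Printing Implicit Defensive.

Import GRing.Theory.
Local Open Scope ring_scope.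

(** * Involutions and determinants in characteristic two *)

Lemma sum_involution_pchar2 {R : nzRingType} {I : finType}
    (f : I -> I) (c : I -> R) :
  2%N \in [pchar R] -> involutive f -> (forall i, c (f i) = c i) ->
  \sum_i c i = \sum_(i | f i == i) c i.
Proof.
move=> char2 fK cf.
rewrite (bigID (fun i => f i == i)) /= -[RHS]addr0; congr (_ + _).
(* Each moved pair [i], [f i] has one member of smaller rank. Since [f] exchanges this half with the
   other, the moved terms add up to twice [A], that is 0. *)
rewrite (bigID (fun i => (enum_rank i < enum_rank (f i))%N)) /=.
set A := \sum_(i | _ && (_ < _)%N) _.
rewrite (reindex_inj (inv_inj fK)) (eq_bigl (fun i =>
  (f i != i) && (enum_rank i < enum_rank (f i))%N)) => [|i]; last first.
  rewrite fK eq_sym -leqNgt leq_eqVlt; case: (altP eqP) => //= ne_fi.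
  by rewrite val_eqE (inj_eq enum_rank_inj) eq_sym (negbTE ne_fi).
under eq_bigr do rewrite cf.
by rewrite -/A -mulr2n -mulr_natr (pcharf0 char2) mulr0.
Qed.

Lemma det_pchar2 {R : comNzRingType} {n : nat} (A : 'M[R]_n) :
  2%N \in [pchar R] -> \det A = \sum_(s : 'S_n) \prod_i A i (s i).
Proof.
move=> char2; apply: eq_bigr => s _.
by case: (odd_perm s); rewrite /= ?expr1 ?expr0 ?mul1r // mulN1r oppr_pchar2.
Qed.

(** * Reversing one cycle of a permutation *)

Section ReverseOrbit.

Variables (T : finType) (x : T).
Implicit Types s : {perm T}.

Lemma mem_porbit_perm s y z : (s y \in porbit s z) = (y \in porbit s z).
Proof. by rewrite -!eq_porbit_mem -[in RHS](porbit_perm s 1 y) expg1. Qed.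

Lemma mem_porbit_permV s y z : (s^-1%g y \in porbit s z) = (y \in porbit s z).
Proof. by rewrite -[in RHS](permKV s y) mem_porbit_perm. Qed.

Lemma eq_in_porbit s s' y :
  {in porbit s y, s' =1 s} -> porbit s' y = porbit s y.
Proof.
move=> eq_s.
have eqX i : (s' ^+ i)%g y = (s ^+ i)%g y.
  by elim: i => [|i IHi]; rewrite ?expg0 // !expgSr !permM IHi eq_s ?mem_porbit.
apply/setP => z; apply/porbitP/porbitP => -[i ->]; exists i;
  by rewrite eqX.
Qed.

Definition rev_porbit_fun s y :=
  if y \in porbit s x then s^-1%g y else s y.

Lemma rev_porbit_fun_inj s : injective (rev_porbit_fun s).
Proof.
move=> y z; rewrite /rev_porbit_fun.
case: ifP => Oy; case: ifP => Oz; try exact: perm_inj.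
  by move=> eq_yz; rewrite -(mem_porbit_perm s z) -eq_yz mem_porbit_permV Oy in Oz.
by move=> eq_yz; rewrite -(mem_porbit_perm s y) eq_yz mem_porbit_permV Oz in Oy.
Qed.

Definition rev_porbit s : {perm T} := perm (@rev_porbit_fun_inj s).

Lemma rev_porbitE s y :
  rev_porbit s y = if y \in porbit s x then s^-1%g y else s y.
Proof. by rewrite permE. Qed.

Lemma porbit_rev s : porbit (rev_porbit s) x = porbit s x.
Proof.
by rewrite -[RHS]porbitV; apply: eq_in_porbit => y; rewrite porbitV rev_porbitE => ->.
Qed.

Lemma porbit_rev_notin s y :
  y \notin porbit s x -> porbit (rev_porbit s) y = porbit s y.
Proof.
move=> Oy; apply: eq_in_porbit => z Oz; rewrite rev_porbitE ifN //.
by apply: contra Oy => Ozx; move: Oz; rewrite -!eq_porbit_mem in Ozx * => /eqP <-.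
Qed.

Lemma rev_porbitK : involutive rev_porbit.
Proof.
move=> s; apply/permP => y; rewrite rev_porbitE porbit_rev.
case: ifP => Oy; last by rewrite rev_porbitE Oy.
by apply: (canLR (permK _)); rewrite rev_porbitE mem_porbit_perm Oy permK.
Qed.

(** Substituting [s y] for [y] on the orbit turns [A y (s^-1 y)] into [A (s y) y], which symmetry
    turns into [A y (s y)]. *)
Lemma prod_rev_porbit {R : comPzSemiRingType} (A : T -> T -> R) s :
  {in porbit s x &, forall y z, A y z = A z y} ->
  \prod_y A y (rev_porbit s y) = \prod_y A y (s y).
Proof.
move=> symA; rewrite (bigID (mem (porbit s x))) [RHS](bigID (mem (porbit s x))).
congr (_ * _); last first.
  by apply: eq_bigr => y /= Oy; rewrite rev_porbitE ifN.
rewrite /= (reindex_inj (@perm_inj _ s)); apply: eq_big => y.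
  exact: mem_porbit_perm.
rewrite mem_porbit_perm => Oy.
by rewrite rev_porbitE mem_porbit_perm Oy permK symA ?mem_porbit_perm.
Qed.

End ReverseOrbit.

(** * The cancelling involution *)

Section ReverseFirstMissed.

Variables (T : finType) (v : T) (K : {set T}).
Implicit Types s : {perm T}.

Definition rev_missed s : {perm T} :=
  if [pick u in K :\: porbit s v] is Some u then rev_porbit u s else s.

(** The choice of [u] depends on [s] only through [porbit s v], which is kept when a cycle disjoint
    from it is reversed. So the second application picks the same [u] and undoes the first. *)
Lemma rev_missedK : involutive rev_missed.
Proof.
move=> s; rewrite {2}/rev_missed.
case pick_u: [pick u in K :\: porbit s v] => [u|]; last by rewrite /rev_missed pick_u.
have: u \notin porbit s v.
  by move: pick_u; case: pickP => // w + [<-]; rewrite inE => /andP[].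
rewrite porbit_sym => /porbit_rev_notin Ov.
by rewrite /rev_missed Ov pick_u rev_porbitK.
Qed.

Lemma prod_rev_missed {R : comPzSemiRingType} (A : T -> T -> R) s :
  (forall y z, y != v -> z != v -> A y z = A z y) ->
  \prod_y A y (rev_missed s y) = \prod_y A y (s y).
Proof.
move=> symA; rewrite /rev_missed; case: pickP => // u.
rewrite inE => /andP[Ou _].
have ne_v y : y \in porbit s u -> y != v.
  by apply: contraTneq => ->; rewrite porbit_sym.
by apply: prod_rev_porbit => y z Oy Oz; apply: symA; apply: ne_v.
Qed.

(** Reversal at a missed [u] would replace [s u] by the different value [s^-1 u], so a fixed [s]
    misses nothing. *)
Lemma rev_missed_fixed s :
  {in K, forall u, s u != s^-1%g u} -> rev_missed s = s ->
  K \subset porbit s v.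
Proof.
move=> neK; rewrite /rev_missed; case: pickP => [u | missed0 _].
  rewrite inE => /andP[_ Ku] /permP/(_ u).
  by rewrite rev_porbitE porbit_id => /esym/eqP; rewrite (negbTE (neK u Ku)).
by rewrite -setD_eq0; apply/eqP/setP => u; rewrite [RHS]inE; apply: missed0.
Qed.

End ReverseFirstMissed.

(** * Matrix entries and permutation products as monomials *)

Section GraphMatrix.

Variables (n : nat) (adj : rel 'I_n) (F : fieldType) (k : nat).
Hypothesis adj_sym : ssrbool.symmetric adj.

Local Notation mnm := 'X_{1..#|{: edge adj}|}.
Local Notation M := (MG adj F k).
Implicit Types (u w : 'I_n) (s : 'S_n) (e : edge adj).

(** A non-edge gets exponent 0, so that the diagonal entries 1 also have the form
    ['X_[edge_mnm u u]]. *)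
Definition edge_mnm u w : mnm :=
  if insub (if (u < w)%N then (u, w) else (w, u)) is Some e
  then U_(enum_rank (e : edge adj))%MM else 0%MM.

Lemma edge_mnmC u w : edge_mnm u w = edge_mnm w u.
Proof. by rewrite /edge_mnm; case: ltngtP => // /val_inj->. Qed.

Lemma edge_mnmE u w e :
  edge_mnm u w (enum_rank e) =
    ((u == (val e).1) && (w == (val e).2) +
     (u == (val e).2) && (w == (val e).1))%N.
Proof.
rewrite /edge_mnm; have /andP[lt_e adj_e] := valP e.
case: insubP => [f edge_f valf | not_edge].
  rewrite mnm1E (inj_eq enum_rank_inj) -val_eqE valf.
  move: lt_e adj_e; case: (val e) => a b /= lt_ab _.
  by case: ltnP => le_uw; rewrite xpair_eqE -!val_eqE /=; lia.
rewrite mnm0E; apply/esym/eqP; rewrite addn_eq0 !eqb0; apply/andP.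
move: not_edge lt_e adj_e; case: (val e) => a b /=.
by split; apply: contra not_edge => /andP[/eqP-> /eqP->];
  rewrite ?lt_e 1?ltnNge ?(ltnW lt_e) /= /is_edge /= lt_e adj_e.
Qed.

Definition live u w : bool :=
  [&& ~~ ((label u == 1) && (label w == k + 2))%N,
      ~~ ((label u == k + 1) && (label w == 1))%N
    & if u == w then (3 * k < label u)%N else adj u w].

Lemma MGE u w : M u w = if live u w then 'X_[edge_mnm u w] else 0.
Proof.
rewrite mxE /live; case: ifP => //= _; case: ifP => //= _.
have [<- | ne_uw] := eqVneq u w.
  rewrite /edge_mnm ltnn; case: ifP => // _.
  by rewrite insubN ?mpolyX0 // /is_edge ltnn.
rewrite /adj_entry /edge_mnm.
have edgeE : is_edge adj (if (u < w)%N then (u, w) else (w, u)) = adj u w.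
  rewrite /is_edge; case: (ltngtP u w) => [lt_uw|lt_wu|/val_inj eq_uw] /=.
  - by rewrite lt_uw.
  - by rewrite lt_wu adj_sym.
  by rewrite eq_uw eqxx in ne_uw.
by case: insubP => [e + _|]; rewrite edgeE; [move->|move/negbTE->].
Qed.

(** Both zeroed entries lie in row or column 1, so the asymmetry is confined there. *)
Lemma MG_sym u w : label u != 1%N -> label w != 1%N -> M u w = M w u.
Proof.
move=> /negbTE u1 /negbTE w1; rewrite !MGE edge_mnmC /live u1 w1 !andbF /=.
by rewrite eq_sym adj_sym; case: eqP => // ->.
Qed.

Definition perm_live s := [forall u, live u (s u)].

Definition perm_mnm s : mnm := (\sum_u edge_mnm u (s u))%MM.

Lemma perm_mnmE s e :
  perm_mnm s (enum_rank e) =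
    ((s (val e).1 == (val e).2) + (s (val e).2 == (val e).1))%N.
Proof.
rewrite mnm_sumE; under eq_bigr do rewrite edge_mnmE; rewrite big_split /=.
by congr addn; rewrite (bigD1 (val e).1) + rewrite (bigD1 (val e).2);
  rewrite //= eqxx big1 ?addn0 // => u /negbTE->.
Qed.

Lemma mcoeff_prod_MG s (m : mnm) :
  (\prod_u M u (s u))@_m = (perm_live s && (perm_mnm s == m))%:R.
Proof.
have [/forallP live_s | /forallPn[u dead_u]] := boolP (perm_live s).
  rewrite -mcoeffX /perm_mnm (big_morph (fun m => 'X_[m]) (mpolyXD F) (mpolyX0 _ F)).
  by congr (_@__); apply: eq_bigr => u _; rewrite MGE live_s.
by rewrite (bigD1 u) //= MGE (negbTE dead_u) mul0r mcoeff0.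
Qed.

Lemma t_prod_dvd (m : mnm) :
  (exists q, 'X_[m] = q * t_prod adj F k) <->
  {in T_edges adj k, forall e, (0 < m (enum_rank e))%N}.
Proof.
pose t : mnm := (\sum_(e in T_edges adj k) U_(enum_rank e))%MM.
have tE e : t (enum_rank e) = (e \in T_edges adj k).
  rewrite mnm_sumE big_mkcond (bigD1 e) //= mnm1E eqxx big1 ?addn0 => [|f ne_f].
    by case: ifP.
  by rewrite mnm1E (inj_eq enum_rank_inj) (negbTE ne_f) if_same.
have -> : t_prod adj F k = 'X_[t].
  by rewrite /t (big_morph (fun m => 'X_[m]) (mpolyXD F) (mpolyX0 _ F)).
split=> [[q def_m] e Te | m_gt0].
  (* The cofactor [q] need not be a monomial, so the exponents are read off the support of the
     product, where every monomial is a multiple of ['X_[t]]. *)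
  have: m \in msupp (q * 'X_[t]) by rewrite -def_m mcoeff_msupp mcoeffX eqxx oner_eq0.
  by rewrite (perm_mem (msuppMX _ _)) => /mapP[m' _ ->]; rewrite mnmDE tE Te.
exists 'X_[m - t]; rewrite -mpolyXD submK //; apply/mnm_lepP => i.
rewrite -(enum_valK i) tE; case: (boolP (_ \in _)) => //.
exact: m_gt0.
Qed.

(** The monomial records how often each edge is used but forgets the direction. *)
Lemma perm_mnm_adj s s' u w : perm_mnm s' = perm_mnm s -> adj u w -> u != w ->
  ((s' u == w) + (s' w == u) = (s u == w) + (s w == u))%N.
Proof.
move=> eq_m; wlog lt_uw : u w / (u < w)%N => [wlog_uw | adj_uw _].
  move=> adj_uw ne_uw; case: (ltngtP u w) => [/wlog_uw|lt_wu|/val_inj eq_uw]; first exact.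
    by rewrite addnC [RHS]addnC; apply: wlog_uw; rewrite 1?eq_sym // adj_sym.
  by rewrite eq_uw eqxx in ne_uw.
have edge_uw : is_edge adj (u, w) by rewrite /is_edge lt_uw.
by have := perm_mnmE s (Sub (u, w) edge_uw); rewrite -eq_m perm_mnmE !SubK.
Qed.

End GraphMatrix.

(** * The permutation that follows a cyclic sequence *)

Section NextPerm.

Variables (T : finType) (c : seq T).
Hypothesis Uc : uniq c.

(** Since [next c] fixes every point outside [c], this is the cycle [c] extended by the identity. *)
Definition next_perm : {perm T} := perm (can_inj (prev_next Uc)).

Lemma next_permE : next_perm =1 next c.
Proof. exact: permE. Qed.

Lemma next_next_neq x : (2 < size c)%N -> x \in c -> next c (next c x) != x.
Proof.
move=> c_gt2 cx; have [i p def_p] := rot_to cx.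
rewrite -!(next_rot i Uc) def_p.
have: uniq (rot i c) by rewrite rot_uniq.
have: (2 < size (rot i c))%N by rewrite size_rot.
rewrite def_p; case: p {def_p} => [|y [|z p]] //= _.
rewrite !inE !negb_or eqxx => /andP[/and3P[ne_xy ne_xz _] _].
by rewrite [y == x]eq_sym (negbTE ne_xy) eqxx eq_sym.
Qed.

Lemma next_neq_prev x : (2 < size c)%N -> x \in c -> next c x != prev c x.
Proof.
move=> c_gt2 cx; apply: contra (next_next_neq c_gt2 cx) => /eqP->.
by rewrite next_prev.
Qed.

End NextPerm.

(** * Graph cycles and live permutations *)

Section CyclePerm.

Variables (n : nat) (adj : rel 'I_n) (k : nat) (c : seq 'I_n).
Hypothesis adj_sym : ssrbool.symmetric adj.
Hypothesis adj_irr : irreflexive adj.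
Hypothesis c_gt2 : (2 < size c)%N.
Hypothesis Uc : uniq c.
Hypothesis adj_c : path.cycle adj c.

Lemma cycle_nbhd u :
  u \in c -> #|nbhd adj u| = 2%N -> nbhd adj u = [set next c u; prev c u].
Proof.
move=> cu deg2; apply/esym/eqP; rewrite eqEcard deg2 cards2 next_neq_prev //.
rewrite andbT; apply/subsetP => w; rewrite !inE => /orP[] /eqP->.
  exact: next_cycle.
by rewrite adj_sym prev_cycle.
Qed.

(** The direction at [v] propagates along [c]: if [s] follows [next c] at one vertex, using the next
    edge backwards would give two vertices the same image. *)
Lemma next_perm_mnm_inj (s : 'S_n) v :
  v \in c -> s v = next c v -> perm_live adj k s ->
  perm_mnm adj s = perm_mnm adj (next_perm Uc) -> s = next_perm Uc.
Proof.
move=> cv sv /forallP live_s eq_m.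
have ne_adj u w : adj u w -> u != w by apply: contraTneq => ->; rewrite adj_irr.
have on_c i : s (iter i (next c) v) = next c (iter i (next c) v).
  elim: i => //= i; set y := iter i _ v => IHi.
  have cy : y \in c by rewrite /y; elim: (i) => //= j; rewrite mem_next.
  have adj_z : adj (next c y) (next c (next c y)).
    by apply: next_cycle => //; rewrite mem_next.
  have := perm_mnm_adj adj_sym eq_m adj_z (ne_adj _ _ adj_z).
  rewrite !next_permE eqxx; case: eqP => //= _; case: eqP => //.
  rewrite -[X in _ = X]IHi => /perm_inj eq_y.
  by have := next_next_neq Uc c_gt2 cy; rewrite eq_y eqxx.
apply/permP => u; rewrite next_permE.
have [cu | c'u] := boolP (u \in c).
  have: fconnect (next c) v u by rewrite (fconnect_cycle (cycle_next Uc) cv).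
  by move/iter_findex <-.
(* If [s] moved [u], the edge from [u] to [s u] would have to be used by [next c] too. As [next c]
   fixes [u], it would have to send [s u] to [u], against injectivity. *)
have nu : next c u = u by rewrite next_nth (negbTE c'u).
rewrite nu; apply/eqP; apply: contraT => ne_u.
have adj_u : adj u (s u).
  by have /and3P[_ _] := live_s u; rewrite eq_sym (negbTE ne_u).
have := perm_mnm_adj adj_sym eq_m adj_u (ne_adj _ _ adj_u).
rewrite !next_permE eqxx nu [u == _]eq_sym (negbTE ne_u) /=.
case: (next c (s u) =P u) => [eq_u _|_]; last by case: eqP.
case/eqP: ne_u.
by apply: (can_inj (prev_next Uc)); rewrite nu.
Qed.

End CyclePerm.

(** The points [v], [s v] and [s^-1 v] are distinct, which gives length at least 3. The orbit
    contains no fixed point, so each live step in it is an edge. *)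
Lemma perm_cycle_porbit (n : nat) (adj : rel 'I_n) k (s : 'S_n) v :
  perm_live adj k s -> s v != v -> s v != s^-1%g v ->
  exists2 c, is_cycle adj c & c =i porbit s v.
Proof.
move=> /forallP live_s ne_v ne_sv.
have orbitE : fingraph.orbit s v =i porbit s v.
  move=> u; rewrite -fconnect_orbit.
  apply/idP/porbitP => [/iter_findex <-|[i ->]]; last by rewrite permX fconnect_iter.
  by exists (findex s v u); rewrite permX.
exists (fingraph.orbit s v) => //; split.
  have: uniq [:: v; s v; s^-1%g v].
    rewrite /= !inE negb_or eq_sym ne_v ne_sv !andbT /=.
    by apply: contra ne_v => /eqP eq_v; rewrite {1}eq_v permKV.
  move/uniq_leq_size; apply=> u; rewrite orbitE !inE.
  by case/or3P => /eqP->; rewrite ?mem_porbit_permV ?mem_porbit_perm porbit_id.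
rewrite /ucycle orbit_uniq andbT.
apply: (sub_in_cycle (P := mem (porbit s v))) (cycle_orbit (@perm_inj _ s) v).
  move=> u w /= Ou _ /eqP <-.
  have ne_u : s u != u.
    case/porbitP: Ou => i ->; rewrite -!permM -expgSr expgS permM.
    by rewrite (inj_eq perm_inj).
  by have /and3P[_ _] := live_s u; rewrite eq_sym (negbTE ne_u).
by apply/allP => u; rewrite orbitE.
Qed.

(** * Edges at the terminals *)

Section Terminals.

Variables (n k : nat) (adj : rel 'I_n).
Local Notation K := (terminals n k).
Hypothesis Knbhd : {in K, forall u, exists a b : 'I_n,
  [/\ label a = (k + 2 * label u - 1)%N, label b = (k + 2 * label u)%N
    & nbhd adj u = [set a; b]]}.

(** Neighbours of a terminal have larger labels than it, so [(u, w)] is already the ordered form of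
    the edge. *)
Lemma terminal_adj u w : u \in K -> adj u w -> exists2 e : edge adj,
  e \in T_edges adj k & val e = (u, w).
Proof.
move=> Ku adj_uw; have [a [b [la lb Nu]]] := Knbhd Ku.
have := Ku; rewrite inE => le_uk.
have lw : (label w == k + 2 * label u - 1)%N || (label w == k + 2 * label u)%N.
  have: w \in nbhd adj u by rewrite inE.
  by rewrite Nu !inE => /orP[] /eqP->; rewrite ?la ?lb eqxx ?orbT.
have edge_uw : is_edge adj (u, w).
  by rewrite /is_edge adj_uw andbT; move: lw le_uk; rewrite /label /=; lia.
by exists (Sub (u, w) edge_uw); rewrite ?SubK // inE SubK /= le_uk.
Qed.

Lemma T_edge_terminal (e : edge adj) : e \in T_edges adj k -> (val e).1 \in K.
Proof. by rewrite !inE => /andP[]. Qed.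

(** If [s u] and [s^-1 u] coincided, [s] could use only one edge at [u], while both edges at [u]
    belong to [T_edges]. *)
Lemma perm_T_neq (s : 'S_n) :
  {in T_edges adj k, forall e, (0 < perm_mnm adj s (enum_rank e))%N} ->
  {in K, forall u, s u != s^-1%g u}.
Proof.
move=> m_gt0 u Ku; have [a [b [la lb Nu]]] := Knbhd Ku.
have ne_ab : a != b by rewrite -val_eqE; move: la lb; rewrite /label /=; lia.
have used w : w \in nbhd adj u -> (s u == w) || (s w == u).
  rewrite inE => /(terminal_adj Ku)[e Te def_e].
  by have := m_gt0 e Te; rewrite perm_mnmE def_e /=; case: eqP; case: eqP.
apply: contraNneq ne_ab => eq_u.
have [] : a \in nbhd adj u /\ b \in nbhd adj u by rewrite Nu !inE !eqxx orbT.
have only w : w \in nbhd adj u -> w = s u.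
  by case/used/orP => /eqP def_w; rewrite ?def_w // eq_u -def_w permK.
by move=> /only-> /only->.
Qed.

End Terminals.

(** * The two implications *)

Section Directions.

Variables (F : fieldType) (n k : nat) (adj : rel 'I_n).
Local Notation K := (terminals n k).
Hypothesis char2 : 2%N \in [pchar F].
Hypothesis adj_sym : ssrbool.symmetric adj.
Hypothesis adj_irr : irreflexive adj.
Hypothesis k_gt0 : (0 < k)%N.
Hypothesis k_le_n : (k <= n)%N.
Hypothesis Kdeg2 : {in K, forall u, #|nbhd adj u| = 2%N}.
Hypothesis Knbhd : {in K, forall u, exists a b : 'I_n,
  [/\ label a = (k + 2 * label u - 1)%N, label b = (k + 2 * label u)%N
    & nbhd adj u = [set a; b]]}.

Lemma mcoeff_det_MG m :
  (\det (MG adj F k))@_m =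
    \sum_(s : 'S_n) (perm_live adj k s && (perm_mnm adj s == m))%:R.
Proof.
rewrite det_pchar2 ?raddf_sum; last first.
  by have := rmorph_pchar (@mpolyC #|{: edge adj}| F) char2.
by apply: eq_bigr => s _; apply: mcoeff_prod_MG.
Qed.

Let v1 : 'I_n := Ordinal (leq_trans k_gt0 k_le_n).

Lemma label_eq1 u : (label u == 1%N) = (u == v1).
Proof. by []. Qed.

Lemma v1_terminal : v1 \in K.
Proof. by rewrite inE. Qed.

Lemma cycle_of_monomial m :
  m \in msupp (\det (MG adj F k)) ->
  {in T_edges adj k, forall e, (0 < m (enum_rank e))%N} ->
  has_set_cycle adj K.
Proof.
rewrite mcoeff_msupp mcoeff_det_MG => nz_m m_gt0.
have [s fix_s live_m] : exists2 s, rev_missed v1 K s == s &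
    perm_live adj k s && (perm_mnm adj s == m).
  apply/exists_inP; apply: contraR nz_m; rewrite negb_exists_in => /forall_inP no_s.
  rewrite (sum_involution_pchar2 (f := rev_missed v1 K)) //.
  - by rewrite big1 // => s /no_s/negbTE->.
  - exact: rev_missedK.
  (* The indicators are read back as coefficients of products of entries of [MG], where symmetry
     away from [v1] applies. *)
  move=> s; rewrite -!(mcoeff_prod_MG F) //; congr (_@__).
  by apply: prod_rev_missed => u w ne_u ne_w; apply: MG_sym; rewrite ?label_eq1.
case/andP: live_m => live_s /eqP def_m; rewrite -def_m in m_gt0.
have neK := perm_T_neq Knbhd m_gt0.
have ne_v : s v1 != v1.
  by apply: contraNneq (neK _ v1_terminal) => fix_v; rewrite -{2}fix_v permK fix_v.
have [c cyc_c cE] := perm_cycle_porbit live_s ne_v (neK _ v1_terminal).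
exists c => // u; rewrite cE; apply/subsetP.
exact: rev_missed_fixed neK (eqP fix_s).
Qed.

(** The labels from k+1 to 3k belong to neighbours of terminals, and a cycle through a vertex of
    degree 2 visits both its neighbours. Hence every vertex off the cycle has diagonal entry 1. *)
Lemma K_cycle_covers c u :
  is_cycle adj c -> {subset K <= c} -> (label u <= 3 * k)%N -> u \in c.
Proof.
case=> c_gt2 /andP[adj_c Uc] Kc le_u3k.
have [/Kc // | K'u] := boolP (u \in K).
(* In 0-based indices, [u] is a neighbour of the terminal [(u - k) %/ 2]. *)
have le_w : ((u - k) %/ 2 < n)%N.
  by move: k_le_n K'u le_u3k; rewrite inE /label /=; lia.
pose w := Ordinal le_w.
have Kw : w \in K.
  by move: K'u le_u3k; rewrite !inE /label /=; lia.
have [a [b [la lb Nw]]] := Knbhd Kw.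
have: u \in nbhd adj w.
  rewrite Nw !inE -!val_eqE.
  by move: K'u la lb; rewrite inE /label /=; lia.
rewrite (cycle_nbhd adj_sym c_gt2 Uc adj_c (Kc _ Kw) (Kdeg2 Kw)) !inE.
by case/orP => /eqP->; rewrite ?mem_next ?mem_prev Kc.
Qed.

(** Reversal swaps [next] and [prev], so either [c] or [rev c] leaves [v1] in the direction that the
    zeroed entries permit. *)
Lemma orient_K_cycle : has_set_cycle adj K -> exists c,
  [/\ is_cycle adj c, {subset K <= c} & label (next c v1) = k.+1].
Proof.
case=> c cyc_c Kc; have [c_gt2 /andP[adj_c Uc]] := cyc_c.
have [a [b [la _ Nv]]] := Knbhd v1_terminal.
have: a \in nbhd adj v1 by rewrite Nv !inE eqxx.
rewrite (cycle_nbhd adj_sym c_gt2 Uc adj_c (Kc _ v1_terminal)) ?Kdeg2 ?v1_terminal //.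
have {}la : label a = k.+1 by rewrite la /label /=; lia.
rewrite !inE => /orP[] /eqP def_a; [exists c | exists (rev c)].
  by rewrite -def_a.
split; last by rewrite next_rev // -def_a.
  split; first by rewrite size_rev.
  rewrite /ucycle rev_uniq Uc andbT rev_cycle.
  by rewrite (eq_cycle (e' := adj)).
by move=> u /Kc; rewrite mem_rev.
Qed.

Lemma monomial_of_cycle : has_set_cycle adj K -> exists2 m,
  m \in msupp (\det (MG adj F k)) &
  {in T_edges adj k, forall e, (0 < m (enum_rank e))%N}.
Proof.
case/orient_K_cycle => c [cyc_c Kc next_v1].
have [c_gt2 /andP[adj_c Uc]] := cyc_c.
have cv1 := Kc _ v1_terminal.
pose s := next_perm Uc; exists (perm_mnm adj s); last first.
  move=> e Te; have Ke := T_edge_terminal Te; rewrite perm_mnmE !next_permE.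
  have: (val e).2 \in nbhd adj (val e).1.
    by rewrite inE; have /andP[] := valP e.
  rewrite (cycle_nbhd adj_sym c_gt2 Uc adj_c (Kc _ Ke) (Kdeg2 Ke)) !inE.
  by case/orP => /eqP->; rewrite ?next_prev ?eqxx ?addn1.
have live_s : perm_live adj k s.
  apply/forallP => u; rewrite next_permE; apply/and3P; split.
  - rewrite label_eq1; apply/negP => /andP[/eqP-> /eqP].
    by rewrite next_v1; lia.
  (* Using entry (k+1, 1) would mean returning to [v1] right after the first step, which length at
     least 3 excludes. *)
  - rewrite [label _ == 1%N]label_eq1; apply/negP => /andP[/eqP lu /eqP nu].
    case/eqP: (next_next_neq Uc c_gt2 cv1).
    suff -> : next c v1 = u by [].
    by apply: val_inj; move: next_v1 lu; rewrite /label /=; lia.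
  have [cu | c'u] := boolP (u \in c).
    have adj_u := next_cycle adj_c cu.
    by case: eqP => // eq_u; rewrite -eq_u adj_irr in adj_u.
  rewrite next_nth (negbTE c'u) eqxx ltnNge; apply: contra c'u.
  exact: K_cycle_covers.
rewrite mcoeff_msupp mcoeff_det_MG (bigD1 s) //= live_s eqxx big1 ?addr0 ?oner_eq0 //.
move=> s' ne_s'; case: andP => // -[live_s' /eqP eq_m]; case/eqP: ne_s'.
apply: (next_perm_mnm_inj adj_sym adj_irr c_gt2 adj_c cv1 _ live_s' eq_m).
(* The diagonal entry at [v1] is 0 and entry (1, k+2) is zeroed, so a live [s'] must send [v1] to
   the vertex labelled k+1, as [s] does. *)
have /and3P[not_b _ adj_s'] := forallP live_s' v1.
have {}adj_s' : s' v1 \in nbhd adj v1.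
  rewrite inE; move: adj_s'; case: eqP => // _.
  by rewrite /label /=; lia.
have [a [b [la lb Nv]]] := Knbhd v1_terminal.
move: adj_s' not_b; rewrite Nv !inE => /orP[] /eqP->.
  by move=> _; apply: val_inj; move: la next_v1; rewrite /label /=; lia.
by rewrite lb /label /=; lia.
Qed.

End Directions.

Theorem theorem7 (F : fieldType) (charF2 : 2%N \in [pchar F])
  (n k : nat) (adj : rel 'I_n) (Gsimple : simple_graph adj)
  (k_gt1 : (1 < k)%N) (k_le_n : (k <= n)%N)
  (Kindep : independent adj (terminals n k))
  (Kdeg2 : {in terminals n k, forall u, #|nbhd adj u| = 2%N})
  (Knbhd : {in terminals n k, forall u, exists a b : 'I_n,
     [/\ label a = (k + 2 * label u - 1)%N, label b = (k + 2 * label u)%N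
       & nbhd adj u = [set a; b]]})
  (Kcommon : {in terminals n k &, forall u w,
     u != w -> [disjoint nbhd adj u & nbhd adj w]}) :
  has_set_cycle adj (terminals n k) <->
  exists2 m : 'X_{1..#|{: edge adj}|},
    m \in msupp (\det (MG adj F k)) &
    exists q : {mpoly F[#|{: edge adj}|]}, 'X_[m] = q * t_prod adj F k.
Proof.
have [adj_sym adj_irr] := Gsimple; have k_gt0 := ltnW k_gt1.
split=> [K_cycle | [m m_supp /t_prod_dvd m_gt0]].
  have [m m_supp m_gt0] :=
    monomial_of_cycle charF2 adj_sym adj_irr k_gt0 k_le_n Kdeg2 Knbhd K_cycle.
  by exists m => //; apply/t_prod_dvd.
exact: (cycle_of_monomial charF2 adj_sym k_gt0 k_le_n Knbhd m_supp m_gt0).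
Qed.
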